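(* Consider the averaged phase oscillator network $\dot\theta_k=\omega+\varepsilon\sum_{j=1}^N\mathrm{h}(\theta_j-\theta_k)$, $\theta_k\in\mathbb{T}$, whose coupling function $\mathrm{h}:\mathbb{T}\to\mathbb{R}$ is $$\mathrm{h}(\vartheta)=\frac{1}{2\pi}\int_0^{2\pi}\langle Z(\vartheta+s),\hat{\mathrm{g}}(s,\vartheta+s)\rangle\,\mathrm{d}s=\frac{1}{2\pi}\sum_{\ell=1}^d\int_0^{2\pi}\hat{\mathrm{h}}_\ell(s,\vartheta+s)\,\mathrm{d}s,\qquad \hat{\mathrm{h}}_\ell(\psi,\phi)=Z_\ell(\phi)\,\hat{\mathrm{g}}_\ell(\psi,\phi),$$ and suppose that $A\subset\mathbb{T}$ is an interval. If the set of phases in $\mathbb{T}^2$ where the components differ by elements in $A$ is contained in the zero set of all $\hat{\mathrm{h}}_\ell$, that is, if $$\{(s,s-\vartheta)\in\mathbb{T}^2 : \vartheta\in A\}\subset\bigcap_{\ell=1}^d \mathrm{N}(\hat{\mathrm{h}}_\ell),$$ then $A\subset\mathrm{DZ}(\mathrm{h})$.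
   Context: $\mathbb{T}=\mathbb{R}/2\pi\mathbb{Z}$; in the displayed set, $s$ ranges over $\mathbb{T}$. $\mathrm{N}(F)=\{x : F(x)=0\}$ denotes the zero set of a function $F$, and $\langle\cdot,\cdot\rangle$ is the usual scalar product on $\mathbb{R}^d$. The network arises from averaging the phase reduction of a weakly coupled network $\dot x_k=\mathrm{f}(x_k)+\varepsilon\sum_{j\ne k}\mathrm{g}(x_j,x_k)$, $x_k\in\mathbb{R}^d$, $d>1$, $k=1,\dots,N$, whose uncoupled node dynamics $\dot x=\mathrm{f}(x)$ has an asymptotically stable limit cycle $\gamma$ with minimal period $2\pi/\omega$ and orbit $\Gamma$. The asymptotic phase $\nu$ assigns to each $y_0$ in the basin of attraction of $\Gamma$ the $\psi\in\mathbb{T}$ such that $\|\gamma(\psi/\omega+t)-y(t)\|\to0$ as $t\to\infty$, where $y$ is the trajectory of $y_0$; $\nu^{-1}(\psi)$ denotes the point of $\Gamma$ with phase $\psi$. $Z=(Z_1,\dots,Z_d):\mathbb{T}\to\mathbb{R}^d$, $Z(\vartheta)=\operatorname{grad}(\nu)|_{\nu^{-1}(\vartheta)}$, is the phase response curve, and $\hat{\mathrm{g}}=(\hat{\mathrm{g}}_1,\dots,\hat{\mathrm{g}}_d):\mathbb{T}^2\to\mathbb{R}^d$ is $\hat{\mathrm{g}}(\theta_j,\theta_k)=\mathrm{g}(\nu^{-1}(\theta_j),\nu^{-1}(\theta_k))$. A dead zone of $\mathrm{h}$ is a maximal connected open set of phase differences $\vartheta\in\mathbb{T}$ on which $\mathrm{h}=0$;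 $\mathrm{DZ}(\mathrm{h})$ is the union of all dead zones of $\mathrm{h}$.
   Formalization: A is taken to be an open interval (dead zones are open), and the inconsistent sign is mended in both ways: with pairs (s,s+ϑ) the conclusion is A⊂DZ(h); with pairs (s,s−ϑ) as displayed it is A⊂DZ(ϑ↦h(−ϑ)). *)

(* Defs.v *)
From HB Require Import structures.
From mathcomp Require Import all_boot all_order all_algebra.
From mathcomp Require Import all_classical all_reals all_analysis.

Set Implicit Arguments.
Unset Strict Implicit.
Unset Printing Implicit Defensive.

Import Order.TTheory GRing.Theory Num.Theory.
Import numFieldNormedType.Exports.

Local Open Scope classical_set_scope.
Local Open Scope ring_scope.
Local Open Scope quotient_scope.

Definition period_lattice (R : realType) : {pred R} :=
  fun x => `[< exists k : int, x = (2 * pi) *~ k >].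

Lemma period_lattice_zmod_closed (R : realType) :
  zmod_closed (@period_lattice R).
Proof.
split=> [|x y]; first by apply/asboolP; exists 0.
move=> /asboolP[k ->] /asboolP[l ->].
by apply/asboolP; exists (k - l); rewrite mulrzBr.
Qed.

HB.instance Definition _ (R : realType) :=
  GRing.isZmodClosed.Build R (@period_lattice R) (@period_lattice_zmod_closed R).

(* T = R / 2 pi Z, with the quotient group structure and quotient topology. *)
Definition circle (R : realType) : Type :=
  quotient_topology (Quotient.quot (@period_lattice R)).

HB.instance Definition _ (R : realType) := Topological.on (circle R).
HB.instance Definition _ (R : realType) :=
  GRing.isZmodule.Build (circle R)
    (@Quotient.addqA _ (@period_lattice R)) (@Quotient.addqC _ (@period_lattice R))
    (@Quotient.add0q _ (@period_lattice R)) (@Quotient.addNq _ (@period_lattice R)).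

Definition circ (R : realType) (x : R) : circle R :=
  \pi_(Quotient.quot (@period_lattice R)) x.

Lemma circ_eqP (R : realType) (x y : R) :
  circ x = circ y <-> exists k : int, x - y = (2 * pi) *~ k.
Proof.
have e := Quotient.idealrBE (@period_lattice R) x y.
have p : (x - y \in @period_lattice R) = `[< exists k : int, x - y = (2 * pi) *~ k >].
  by [].
split=> xy; first by apply/asboolP; rewrite -p e; apply/eqP.
by have /eqP := etrans (etrans (esym e) p) (asboolT xy).
Qed.

Lemma circD (R : realType) (x y : R) : circ (x + y) = circ x + circ y.
Proof. exact: raddfD. Qed.

Lemma circN (R : realType) (x : R) : circ (- x) = - circ x.
Proof. exact: raddfN. Qed.

Lemma circ_surj (R : realType) (th : circle R) : exists x : R, circ x = th.
Proof. by exists (repr th); exact: reprK. Qed.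

Lemma circ_continuous (R : realType) : continuous (@circ R).
Proof. exact: pi_continuous. Qed.

Definition circle_interval (R : realType) (A : set (circle R)) : Prop :=
  exists I : interval R, A = @circ R @` [set` I].

Definition dotv (R : realType) (d : nat) (u v : 'rV[R]_d) : R :=
  \sum_(l < d) u 0 l * v 0 l.

(* Only the values at t >= 0 matter.  A one-sided solution is extended to
   t < 0 by y0 + t f(y0), so the two-sided derivative at 0 is no restriction. *)
Definition trajectory (R : realType) (d : nat) (f : 'rV[R]_d -> 'rV[R]_d)
    (y0 : 'rV[R]_d) (y : R -> 'rV[R]_d) : Prop :=
  y 0 = y0 /\ forall t : R, 0 <= t -> is_derive t 1 y (f (y t)).

(* The norm of 'rV[R]_d is the sup norm; only neighbourhoods and limits are
   taken, for which it is interchangeable with the Euclidean norm. *)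
Definition tube (R : realType) (d : nat) (G : set 'rV[R]_d) (e : R) :
    set 'rV[R]_d :=
  [set x | exists2 p, G p & `|x - p| < e].

(* Trajectories are not assumed unique: every one has to behave as required,
   and at least one has to exist for all times. *)
Definition basin (R : realType) (d : nat) (f : 'rV[R]_d -> 'rV[R]_d)
    (G : set 'rV[R]_d) : set 'rV[R]_d :=
  [set y0 | (exists y, trajectory f y0 y) /\
     forall y, trajectory f y0 y ->
       forall e : R, 0 < e -> \forall t \near +oo, tube G e (y t)].

Definition asymptotically_stable (R : realType) (d : nat)
    (f : 'rV[R]_d -> 'rV[R]_d) (G : set 'rV[R]_d) : Prop :=
  (forall e : R, 0 < e -> exists2 r : R, 0 < r &
     forall y0 y, tube G r y0 -> trajectory f y0 y ->
       forall t : R, 0 <= t -> tube G e (y t)) /\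
  (exists2 r : R, 0 < r & tube G r `<=` basin f G).

Definition minimal_period (R : realType) (d : nat) (gam : R -> 'rV[R]_d)
    (p : R) : Prop :=
  [/\ 0 < p, forall t, gam (t + p) = gam t &
      forall q : R, 0 < q < p -> ~ (forall t, gam (t + q) = gam t)].

(* Having a positive minimal period, gam is not an equilibrium; an
   asymptotically stable periodic orbit is isolated, hence a limit cycle. *)
Definition stable_limit_cycle (R : realType) (d : nat)
    (f : 'rV[R]_d -> 'rV[R]_d) (omega : R) (gam : R -> 'rV[R]_d) : Prop :=
  [/\ forall t : R, is_derive t 1 gam (f (gam t)),
      minimal_period gam (2 * pi / omega) &
      asymptotically_stable f (range gam)].

(* The values of nu outside the basin are irrelevant.  By periodicity of gam
   the limit does not depend on the representative psi of nu y0. *)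
Definition asymptotic_phase (R : realType) (d : nat)
    (f : 'rV[R]_d -> 'rV[R]_d) (omega : R) (gam : R -> 'rV[R]_d)
    (nu : 'rV[R]_d -> circle R) : Prop :=
  forall (y0 : 'rV[R]_d) (y : R -> 'rV[R]_d) (psi : R),
    basin f (range gam) y0 -> trajectory f y0 y -> circ psi = nu y0 ->
    `|gam (psi / omega + t) - y t| @[t --> +oo] --> (0 : R).

Definition phase_point (R : realType) (d : nat) (gam : R -> 'rV[R]_d)
    (nu : 'rV[R]_d -> circle R) (psi : circle R) : 'rV[R]_d :=
  xget 0 [set x | range gam x /\ nu x = psi].

(* A circle-valued map is differentiated through a real-valued local lift;
   two lifts continuous at p differ near p by a constant. *)
Definition is_grad (R : realType) (d : nat) (nu : 'rV[R]_d -> circle R)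
    (p v : 'rV[R]_d) : Prop :=
  exists2 n : 'rV[R]_d -> R,
    (\forall x \near p, circ (n x) = nu x) & is_diff p n (dotv v).

Definition phase_response_curve (R : realType) (d : nat) (gam : R -> 'rV[R]_d)
    (nu : 'rV[R]_d -> circle R) (Z : circle R -> 'rV[R]_d) : Prop :=
  forall th, is_grad nu (phase_point gam nu th) (Z th).

Definition phase_interaction (R : realType) (d : nat)
    (g : 'rV[R]_d -> 'rV[R]_d -> 'rV[R]_d) (gam : R -> 'rV[R]_d)
    (nu : 'rV[R]_d -> circle R) (x : circle R * circle R) : 'rV[R]_d :=
  g (phase_point gam nu x.1) (phase_point gam nu x.2).

Definition hhat (R : realType) (d : nat) (Z : circle R -> 'rV[R]_d)
    (gh : circle R * circle R -> 'rV[R]_d) (l : 'I_d)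
    (x : circle R * circle R) : R :=
  Z x.2 0 l * gh x 0 l.

(* Sign pitfall: th is here the second phase minus the first.  With
   gh (th_j, th_k) acting on oscillator k, averaging yields an interaction
   coupling (- (th_j - th_k)). *)
Definition coupling (R : realType) (d : nat) (Z : circle R -> 'rV[R]_d)
    (gh : circle R * circle R -> 'rV[R]_d) (th : circle R) : R :=
  (2 * pi)^-1 * \int[@lebesgue_measure R]_(s in `[0, 2 * pi])
    dotv (Z (th + circ s)) (gh (circ s, th + circ s)).

Lemma coupling_hhat (R : realType) (d : nat) (Z : circle R -> 'rV[R]_d)
    (gh : circle R * circle R -> 'rV[R]_d) (th : circle R) :
  (forall l, (@lebesgue_measure R).-integrable `[0, 2 * pi]
     (fun s => (hhat Z gh l (circ s, th + circ s))%:E)) ->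
  coupling Z gh th = (2 * pi)^-1 *
    \sum_(l < d) \int[@lebesgue_measure R]_(s in `[0, 2 * pi])
      hhat Z gh l (circ s, th + circ s).
Proof.
move=> ih; congr (_ * _); rewrite /Rintegral sum_fine; last first.
  by move=> l _; exact: integrable_fin_num.
under eq_integral do rewrite -sumEFin.
by rewrite integral_sum.
Qed.

Definition zero_set (T : Type) (R : realType) (F : T -> R) : set T :=
  [set x | F x = 0].

Definition open_connected_zeros (R : realType) (h : circle R -> R)
    (U : set (circle R)) : Prop :=
  [/\ open U, connected U & U `<=` zero_set h].

Definition dead_zone (R : realType) (h : circle R -> R) (U : set (circle R)) :
    Prop :=
  [/\ U !=set0, open_connected_zeros h U &
      forall V, open_connected_zeros h V -> U `<=` V -> V = U].

Definition DZ (R : realType) (h : circle R -> R) : set (circle R) :=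
  \bigcup_(U in dead_zone h) U.

(* Main.v *)
Require Import Defs.
From HB Require Import structures.
From mathcomp Require Import all_boot all_order all_algebra.
From mathcomp Require Import all_classical all_reals all_analysis.

Set Implicit Arguments.
Unset Strict Implicit.
Unset Printing Implicit Defensive.

Import Order.TTheory GRing.Theory Num.Theory.
Import numFieldNormedType.Exports.

Local Open Scope classical_set_scope.
Local Open Scope ring_scope.

(** For [th] in [A], the integral defining [coupling] at [th] samples each [hhat] only at points
    [(s, s + th)], where it vanishes by assumption, so [h] is zero on [A] ([coupling_eq0]). As a
    continuous image of a real interval [A] is connected; being also open, it lies in a maximal
    connected open set of zeros ([sub_DZ]). *)

Lemma circle_interval_connected (R : realType) (A : set (circle R)) :
  circle_interval A -> connected A.
Proof.
move=> [I ->]; apply: connected_continuous_connected.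
  by apply/connected_intervalP; exact: interval_is_interval.
by apply: continuous_subspaceT; exact: circ_continuous.
Qed.

(** The dead zone around [x] is the union [U] of all open connected sets of zeros through [x]; it is
    connected because they share [x]. *)
Lemma sub_DZ (R : realType) (h : circle R -> R) (A : set (circle R)) :
  open_connected_zeros h A -> A `<=` DZ h.
Proof.
move=> zA x Ax.
pose F := [set V | open_connected_zeros h V /\ V x].
pose U := \bigcup_(V in F) V.
have UF V : open_connected_zeros h V -> V x -> V `<=` U.
  by move=> zV Vx y Vy; exists V.
have Ux : U x by exact: (UF A).
exists U => //; split; [by exists x| |].
- split.
  + by apply: bigcup_open => V [[]].
  + apply: bigcup_connected; first by exists x => V [].
    by move=> V [[]].
  + by move=> y [V [[_ _ zV] _] Vy]; exact: zV.
(* Maximality: a competitor [V] above [U] contains [x], so it is itself a member of [F]. *)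
- by move=> V zV UV; apply/seteqP; split=> //; apply: (UF V) => //; exact: UV.
Qed.

Lemma coupling_eq0 (R : realType) (d : nat) (Z : circle R -> 'rV[R]_d)
    (gh : circle R * circle R -> 'rV[R]_d) (th : circle R) :
  (forall s l, hhat Z gh l (s, s + th) = 0) -> coupling Z gh th = 0.
Proof.
move=> zero; rewrite /coupling /Rintegral integral0_eq ?mulr0// => s _.
congr EFin; apply: big1 => l _.
by rewrite addrC; exact: zero.
Qed.

(** The two halves are the two sign conventions for the phase difference: second minus first, as in
    [coupling], or first minus second, which reflects [h]. Since [DZ] is open, openness of [A] rules
    out cases such as a single isolated zero of [h]. *)
Theorem proposition2 (R : realType) (d : nat) (hd : (1 < d)%N)
    (f : 'rV[R]_d -> 'rV[R]_d) (g : 'rV[R]_d -> 'rV[R]_d -> 'rV[R]_d)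
    (omega : R) (homega : 0 < omega)
    (gam : R -> 'rV[R]_d) (hgam : stable_limit_cycle f omega gam)
    (nu : 'rV[R]_d -> circle R) (hnu : asymptotic_phase f omega gam nu)
    (Z : circle R -> 'rV[R]_d) (hZ : phase_response_curve gam nu Z)
    (A : set (circle R)) (hA : circle_interval A) (oA : open A) :
  let gh := phase_interaction g gam nu in
  let h := coupling Z gh in
  ([set (s, s + th) | s in [set: circle R] & th in A]
     `<=` \bigcap_(l in [set: 'I_d]) zero_set (hhat Z gh l) ->
   A `<=` DZ h) /\
  ([set (s, s - th) | s in [set: circle R] & th in A]
     `<=` \bigcap_(l in [set: 'I_d]) zero_set (hhat Z gh l) ->
   A `<=` DZ (fun th => h (- th))).
Proof.
move=> gh h; have cA := circle_interval_connected hA.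
(* In the second half [coupling_eq0] is used at [- th], as [s - th] is [s + (- th)]. *)
split=> sub; apply: sub_DZ; split=> // th Ath; apply: coupling_eq0 => s l;
  by apply: sub => //; exists s => //; exists th.
Qed.
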